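(* Let $X\subset[0,1]$. Then $$\overline{\dim}_{GB}(X)=\limsup_{m\to\infty}\frac{\log g_m(X)}{\log m},$$ where $g_m(X)=\sum_{k=1}^{m}\min\Big\{m,\ \#\big(X\cap[\tfrac{k-1}{m},\tfrac{k}{m}]\big)\Big\}$.
   Context: For $\delta>0$ and $F\subset\mathbb{R}^d$, $N_\delta(F)$ denotes the number of cubes of the standard $\delta$-grid $\{\prod_{i=1}^d[n_i\delta,(n_i+1)\delta]: n_i\in\mathbb{Z}\}$ that intersect $F$, and the upper box dimension is $\overline{\dim}_B(F)=\limsup_{\delta\to0}\frac{\log N_\delta(F)}{-\log\delta}$. $C_u(X)$ denotes the set of uniformly continuous real functions on $X$, and for $f\in C_u(X)$, $\mathrm{graph}(f)=\{(x,f(x)):x\in X\}$. The upper graph box dimension of $X$ is $\overline{\dim}_{GB}(X)=\sup_{f\in C_u(X)}\overline{\dim}_B(\mathrm{graph}(f))$. $\#A$ denotes the cardinality of $A$ (possibly infinite; $\min\{m,\infty\}=m$). *)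

(* Defs.v *)
From HB Require Import structures.
From mathcomp Require Import all_boot all_order all_algebra.
From mathcomp Require Import all_classical all_reals all_analysis.
From mathcomp Require Import finmap.

Set Implicit Arguments. Unset Strict Implicit. Unset Printing Implicit Defensive.
Import Order.TTheory GRing.Theory Num.Theory.
Import numFieldTopology.Exports.
Local Open Scope classical_set_scope.
Local Open Scope ring_scope.
Local Open Scope fset_scope.

Section defs.
Variable R : realType.

Definition grid_cubes (d : R) (F : set (R * R)) : set (int * int) :=
  [set n | exists p, F p /\
     (n.1%:~R * d <= p.1 <= (n.1 + 1)%:~R * d) /\
     (n.2%:~R * d <= p.2 <= (n.2 + 1)%:~R * d)].

Definition box_ratio (F : set (R * R)) (d : R) : \bar R :=
  if `[< finite_set (grid_cubes d F) >] then
    ((ln (#|` fset_set (grid_cubes d F) |)%:R) / (- ln d))%:E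
  else +oo%E.

Definition upper_box_dim (F : set (R * R)) : \bar R :=
  limf_esup (box_ratio F) ((0:R)^'+).

Definition unif_cont_on (X : set R) (f : R -> R) : Prop :=
  forall e : R, 0 < e -> exists2 d : R, 0 < d &
    forall x y, X x -> X y -> `|x - y| < d -> `|f x - f y| < e.

Definition graph_of (X : set R) (f : R -> R) : set (R * R) :=
  [set p | X p.1 /\ p.2 = f p.1].

Definition upper_graph_box_dim (X : set R) : \bar R :=
  ereal_sup [set upper_box_dim (graph_of X f) | f in unif_cont_on X].

Definition has_at_least (A : set R) (j : nat) : Prop :=
  exists s : seq R, [/\ uniq s, size s = j & forall x, x \in s -> A x].

(* min {m, #A}  (with min{m, oo} = m) *)
Definition min_card (m : nat) (A : set R) : nat :=
  \max_(j < m.+1 | `[< has_at_least A j >]) j.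

Definition g_m (X : set R) (m : nat) : nat :=
  \sum_(1 <= k < m.+1)
     min_card m (X `&` `[(k.-1)%:R / m%:R, k%:R / m%:R]).

End defs.

(* Main.v *)
Require Import Defs.
From mathcomp Require Import all_boot all_order all_algebra.
From mathcomp Require Import all_classical all_reals all_analysis.
From mathcomp Require Import finmap zify lra.

Set Implicit Arguments.
Unset Strict Implicit.
Unset Printing Implicit Defensive.
Import Order.TTheory GRing.Theory Num.Theory.
Import numFieldNormedType.Exports.
Local Open Scope classical_set_scope.
Local Open Scope ring_scope.

(** Upper bound: choose [m] with [m^-1 <= d] and [m] comparable to [d^-1].
    Once [f] oscillates by at most [1/2] over a column of width [1/m], the
    graph over that column meets at most a constant times [m] cubes of side
    [d], and at most a constant times the number of points of [X] in the
    column. Hence the graph meets at most [16 g_m] cubes.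

    Lower bound: let [r < r1 < limsup]. Given a uniformly continuous [h] and
    [a > 0], take [m] with [g_m > m ^ r1], so large that [h] oscillates by
    at most [a / 2] over the columns of width [1/m]. A perturbation of size
    at most [a] puts the values at a fixed proportion of the [min {m, #}]
    points of each column at distances at least [3/m] from each other, so
    that every function within [1/m] of the new one has a graph meeting at
    least [c g_m >= m ^ r] cubes of side [1/m]. Iterating gives nested balls
    for the uniform distance, and their common point is uniformly continuous
    with a graph of upper box dimension at least [r]. *)

Section LimfEsup.
Context {T : choiceType} {U : filteredType T} {R : realType}.
Implicit Types (f : U -> \bar R) (F : set_system U) (t : \bar R).
Local Open Scope ereal_scope.

Lemma limf_esup_lt_near f F t : Filter F -> limf_esup f F < t ->
  \forall x \near F, f x < t.
Proof.
move=> FF; rewrite limf_esupE => /ereal_inf_lt[_ [V FV <-]] sup_lt.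
apply: filterS FV => x Vx; apply: le_lt_trans sup_lt.
by apply: ereal_sup_ubound; exists x.
Qed.

Lemma near_limf_esup_le f F t : (\forall x \near F, f x <= t) ->
  limf_esup f F <= t.
Proof.
move=> f_le; rewrite limf_esupE.
apply: (@le_trans _ _ (ereal_sup (f @` [set x | f x <= t]))).
  by apply: ereal_inf_lbound; exists [set x | f x <= t].
by apply: ge_ereal_sup => _ [x ? <-].
Qed.

Lemma limf_esup_gt_meets f F t V : t < limf_esup f F -> F V ->
  exists2 x, V x & t < f x.
Proof.
move=> t_lt FV; have : t < ereal_sup [set f x | x in V].
  apply: lt_le_trans t_lt _; rewrite limf_esupE.
  by apply: ereal_inf_lbound; exists V.
by case/ereal_sup_gt => _ [x Vx <-]; exists x.
Qed.

Lemma meets_limf_esup_ge f F t : Filter F ->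
  (forall V, F V -> exists2 x, V x & t <= f x) -> t <= limf_esup f F.
Proof.
move=> FF meets; rewrite leNgt; apply/negP => /limf_esup_lt_near/meets[x].
by rewrite leNgt => ->.
Qed.

End LimfEsup.

Section EReal.
Context {R : realType}.
Implicit Types x y : \bar R.
Local Open Scope ereal_scope.

Lemma lee_lb_fin x y : (forall t : R, t%:E < x -> t%:E <= y) -> x <= y.
Proof.
move=> t_le; rewrite leNgt; apply/negP => yx.
suff [t yt tx] : exists2 t : R, y < t%:E & t%:E < x.
  by move: (t_le t tx); rewrite leNgt yt.
case: x y yx {t_le} => [x| |] [y| |] //.
- rewrite lte_fin => yx; exists ((x + y) / 2)%R; rewrite lte_fin; lra.
- by exists (x - 1)%R; rewrite ?ltNyr// lte_fin; lra.
- by exists (y + 1)%R; rewrite ?ltry// lte_fin; lra.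
- by exists 0%R; rewrite ?ltNyr ?ltry.
Qed.

Lemma lee_ub_fin x y : (forall t : R, y < t%:E -> x <= t%:E) -> x <= y.
Proof.
move=> le_t; rewrite -leeN2; apply: lee_lb_fin => t.
by rewrite lteNr leeNr -EFinN; exact: le_t.
Qed.

End EReal.

Section LnNat.
Context {R : realType}.
Implicit Types k m n : nat.

Lemma ln_nat_ge0 n : 0 <= ln (n%:R : R).
Proof.
case: n => [|n]; first by rewrite ln0.
by apply: ln_ge0; rewrite ler1n.
Qed.

Lemma ln_natM_le k m n : (0 < k)%N -> (m <= k * n)%N ->
  ln (m%:R : R) <= ln k%:R + ln n%:R.
Proof.
move=> k0; case: m => [|m]; first by rewrite [ln 0]ln0 ?addr_ge0 ?ln_nat_ge0.
case: n => [|n mkn]; first by rewrite muln0.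
rewrite -lnM ?posrE ?ltr0n // -natrM.
by rewrite ler_ln ?posrE ?ltr0n ?muln_gt0 ?k0 // ler_nat.
Qed.

Lemma le_ln_nat m n : (m <= n)%N -> ln (m%:R : R) <= ln n%:R.
Proof.
by move=> mn; have := @ln_natM_le 1 m n; rewrite mul1n ln1 add0r; exact.
Qed.

Lemma cvgy_ln_nat : ln (m%:R : R) @[m --> \oo] --> +oo.
Proof.
apply/cvgryPge => C; near=> m.
have expC : expR C <= m%:R by near: m; exact: nbhs_infty_ger.
by rewrite -ler_expR lnK // posrE (lt_le_trans (expR_gt0 C)).
Unshelve. all: by end_near. Qed.

Lemma near_infty_natV_lt (e : R) : 0 < e -> \forall m \near \oo, m%:R^-1 < e.
Proof.
move=> e0; near=> m.
have em : e^-1 < m%:R by near: m; exact: nbhs_infty_gtr.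
by rewrite -[e]invrK ltf_pV2 ?posrE ?invr_gt0 // (lt_trans _ em) ?invr_gt0.
Unshelve. all: by end_near. Qed.

End LnNat.

Section GrowthExponent.
Context {R : realType}.
Implicit Types (u : nat -> R) (t : R).

Definition growth_exponent u : \bar R :=
  limn_esup (fun m => (ln (u m) / ln m%:R)%:E).

Lemma growth_exponent_nat_ge0 (u : nat -> nat) :
  (0 <= growth_exponent (fun m => (u m)%:R))%E.
Proof.
apply: limf_esup_ge0 => [|m]; first exact: filter_not_empty.
by rewrite lee_fin divr_ge0 // ln_nat_ge0.
Qed.

Lemma growth_exponent_lt_near u t : (growth_exponent u < t%:E)%E ->
  \forall m \near \oo, ln (u m) < t * ln m%:R.
Proof.
move=> /limf_esup_lt_near u_lt; near=> m; rewrite -ltr_pdivrMr.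
  by rewrite -lte_fin; near: m.
by near: m; exact: cvgry_gt cvgy_ln_nat 0.
Unshelve. all: by end_near. Qed.

Lemma growth_exponent_gt_meets u t (V : set nat) :
  (t%:E < growth_exponent u)%E -> \oo V ->
  exists2 m, V m & t * ln m%:R < ln (u m).
Proof.
move=> u_gt oV.
have ln_gt0 : \forall m \near \oo, 0 < ln (m%:R : R).
  exact: cvgry_gt cvgy_ln_nat _.
have [m [Vm lnm]] := limf_esup_gt_meets u_gt (filterI oV ln_gt0).
by rewrite lte_fin ltr_pdivlMr //; exists m.
Qed.

End GrowthExponent.

Section MinCard.
Context {R : realType}.
Implicit Types (A B : set R) (m : nat).

Lemma min_card_le m A : (min_card m A <= m)%N.
Proof. by apply/bigmax_leqP => j _; rewrite -ltnS. Qed.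

Lemma has_at_least_min_card m A : has_at_least A (min_card m A).
Proof.
rewrite /min_card.
have at_least0 : `[< has_at_least A (ord0 : 'I_m.+1) >].
  by apply/asboolP; exists [::].
by rewrite (bigop.bigmax_eq_arg ord0) //; case: arg_maxnP => // j /asboolP.
Qed.

Lemma leq_min_card m A (s : seq R) : uniq s -> (size s <= m)%N ->
  {in s, forall x, A x} -> (size s <= min_card m A)%N.
Proof.
move=> us sm sA.
pose j : 'I_m.+1 := Ordinal (sm : (size s < m.+1)%N).
by apply: (leq_bigmax_cond j); apply/asboolP; exists s.
Qed.

Lemma min_card_sub m A B : A `<=` B -> (min_card m A <= min_card m B)%N.
Proof.
move=> AB; have [s [us ss sA]] := has_at_least_min_card m A.
rewrite -ss leq_min_card // ?ss ?min_card_le // => x /sA; exact: AB.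
Qed.

Lemma min_cardU m A B :
  (min_card m (A `|` B) <= min_card m A + min_card m B)%N.
Proof.
have [s [us ss sAB]] := has_at_least_min_card m (A `|` B).
have count_le (p : pred R) : (count p s <= m)%N.
  by rewrite (leq_trans (count_size _ _)) // ss min_card_le.
pose inA := [pred x | x \in A].
rewrite -ss -(count_predC inA s) -!size_filter.
apply: leq_add; apply: leq_min_card; rewrite ?filter_uniq ?size_filter //.
  by move=> x; rewrite mem_filter => /andP[/set_mem].
by move=> x; rewrite mem_filter => /andP[/negP nA /sAB[/mem_set|]].
Qed.

Lemma min_card_lt_enum m A : (min_card m A < m)%N ->
  exists2 s : seq R, size s = min_card m A & A `<=` [set` s].
Proof.
move=> lt_m; have [s [us ss sA]] := has_at_least_min_card m A.
exists s => // x Ax /=; apply/negPn/negP => xs.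
suff : (size (x :: s) <= min_card m A)%N by rewrite /= ss ltnn.
apply: leq_min_card; rewrite /= ?xs ?ss // => y.
by rewrite inE => /predU1P[->|/sA].
Qed.

Lemma min_card_sparse_enum m (M : nat) A : (0 < M)%N ->
  exists s : seq R, [/\ uniq s, {in s, forall x, A x},
    (min_card m A <= M * size s)%N & forall j, (j < size s)%N -> (j * M < m)%N].
Proof.
move=> M0; have [s [us ss sA]] := has_at_least_min_card m A.
pose n := ((size s + M.-1) %/ M)%N.
have n_le : (n <= size s)%N by rewrite -ltnS ltn_divLR //; nia.
exists (take n s); rewrite size_takel //; split.
- exact: take_uniq.
- by move=> x /mem_take /sA.
- rewrite -ss /n; have := divn_eq (size s + M.-1) M.
  by have := ltn_pmod (size s + M.-1) M0; lia.
- move=> j; rewrite /n leq_divRL // mulSn => jM.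
  by apply: leq_trans (min_card_le m A); rewrite -ss; lia.
Qed.

End MinCard.

Section CubeCounts.
Context {R : realType}.
Implicit Types (F G : set (R * R)) (A X : set R) (f : R -> R) (d : R) (n : nat).

Definition at_most_cubes d F n : Prop :=
  finite_set (grid_cubes d F) /\ (#|` fset_set (grid_cubes d F)| <= n)%N.

Definition at_least_cubes d F n : Prop :=
  finite_set (grid_cubes d F) -> (n <= #|` fset_set (grid_cubes d F)|)%N.

Lemma at_most_cubesP d F n : at_most_cubes d F n <->
  exists2 s : seq (int * int), grid_cubes d F `<=` [set` s] & (size s <= n)%N.
Proof.
split=> [[fin le_n]|[s Fs sn]].
  exists (fset_set (grid_cubes d F)) => // c Fc /=.
  by rewrite in_fset_set // mem_set.
have fin : finite_set (grid_cubes d F) by exact: sub_finite_set (finite_seq s).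
split=> //; apply: leq_trans sn; apply: uniq_leq_size; first exact: fset_uniq.
by move=> c; rewrite in_fset_set // => /set_mem /Fs.
Qed.

Lemma at_least_cubes_uniq d F (s : seq (int * int)) : uniq s ->
  {in s, forall c, grid_cubes d F c} -> at_least_cubes d F (size s).
Proof.
move=> us sF fin; apply: uniq_leq_size => // c cs.
by rewrite in_fset_set // mem_set //; exact: sF.
Qed.

Lemma at_most_cubes_leq d F m n : (m <= n)%N -> at_most_cubes d F m ->
  at_most_cubes d F n.
Proof. by move=> mn [fin le_m]; split=> //; exact: leq_trans mn. Qed.

Lemma at_most_cubes_sub d F G n : F `<=` G -> at_most_cubes d G n ->
  at_most_cubes d F n.
Proof.
move=> FG /at_most_cubesP[s Gs sn]; apply/at_most_cubesP; exists s => //.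
by move=> c [p [Fp cp]]; apply: Gs; exists p; split=> //; exact: FG.
Qed.

Lemma at_most_cubes_bigcup d (I : eqType) (r : seq I) (F : I -> set (R * R))
    (n : I -> nat) :
  {in r, forall i, at_most_cubes d (F i) (n i)} ->
  at_most_cubes d (\bigcup_(i in [set` r]) F i) (\sum_(i <- r) n i).
Proof.
elim: r => [|i r IH] Fn; apply/at_most_cubesP.
  by exists [::]; rewrite ?big_nil // => c [p [[]]].
have /at_most_cubesP[s Fs sn] : at_most_cubes d (F i) (n i).
  by apply: Fn; rewrite mem_head.
have /at_most_cubesP[t Ft tn] :
    at_most_cubes d (\bigcup_(i in [set` r]) F i) (\sum_(i <- r) n i).
  by apply: IH => j jr; apply: Fn; rewrite inE jr orbT.
exists (s ++ t); last by rewrite big_cons size_cat leq_add.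
move=> c [p [[j /= + Fjp] cp]]; rewrite inE mem_cat => /predU1P[ji|jr].
  by apply/orP; left; apply: Fs; exists p; rewrite -ji.
by apply/orP; right; apply: Ft; exists p; split=> //; exists j.
Qed.

Definition int_window (a : int) (l : nat) : seq int :=
  [seq a + i%:Z | i <- iota 0 l].

Lemma mem_int_window a l (k : int) :
  (k \in int_window a l) = (a <= k < a + l%:Z).
Proof.
apply/mapP/idP => [[i + ->]|ak]; first by rewrite mem_iota; lia.
by exists `|k - a|%N; rewrite ?mem_iota; lia.
Qed.

Lemma mem_grid_window d (u t : R) (l : nat) (k : int) : 0 < d ->
  u <= t <= u + l%:R * d -> k%:~R * d <= t <= (k + 1)%:~R * d ->
  k \in int_window (Num.floor (u / d) - 1) (l + 3).
Proof.
move=> d0 /andP[ut tv] /andP[kt tk]; rewrite mem_int_window.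
have /andP[floor_le lt_floor] := floor_itv (u / d).
have : Num.floor (u / d) <= k + 1.
  by rewrite -(ler_int R) (le_trans floor_le) // ler_pdivrMr //; lra.
have : k < Num.floor (u / d) + 1 + l%:Z.
  rewrite -(ltr_int R) intrD; apply: (@le_lt_trans _ _ (u / d + l%:R)).
    by rewrite -(ler_pM2r d0) mulrDl divfK ?gt_eqF //; lra.
  by rewrite ltrD2r.
lia.
Qed.

Lemma at_most_cubes_rectangle d (u v : R) (k l : nat) F : 0 < d ->
  (forall p, F p -> u <= p.1 <= u + k%:R * d /\ v <= p.2 <= v + l%:R * d) ->
  at_most_cubes d F ((k + 3) * (l + 3)).
Proof.
move=> d0 F_rect; apply/at_most_cubesP.
exists [seq (i, j) | i <- int_window (Num.floor (u / d) - 1) (k + 3),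
                     j <- int_window (Num.floor (v / d) - 1) (l + 3)].
  move=> [i j] [p [/F_rect[p1 p2] [/= ip jp]]] /=.
  apply: allpairs_f; first exact: mem_grid_window p1 ip.
  exact: mem_grid_window p2 jp.
by rewrite size_allpairs !size_map !size_iota.
Qed.

Lemma graph_of_seq f (s : seq R) :
  graph_of [set` s] f = \bigcup_(x in [set` s]) [set (x, f x)].
Proof.
apply/seteqP; split=> [[x y] [/= xs ->]|_ [x xs ->]]; last by split.
by exists x.
Qed.

Lemma at_most_cubes_graph_seq d f (s : seq R) : 0 < d ->
  at_most_cubes d (graph_of [set` s] f) (9 * size s).
Proof.
move=> d0; rewrite graph_of_seq mulnC -sum1_size big_distrl /=.
apply: at_most_cubes_bigcup => x _.
apply: (at_most_cubes_rectangle (u := x) (v := f x) (k := 0) (l := 0)) => //.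
move=> _ -> /=.
by rewrite mul0r !addr0 !lexx.
Qed.

Lemma at_most_cubes_graph_column d A f (u : R) (m : nat) : 0 < d ->
  d^-1 <= m%:R -> A `<=` `[u, u + d] ->
  (forall x y, A x -> A y -> `|f x - f y| <= 2^-1) ->
  at_most_cubes d (graph_of A f) (16 * min_card m A).
Proof.
move=> d0 dm Au fA.
have m0 : (0 < m)%N by rewrite -(ltr_nat R) (lt_le_trans _ dm) ?invr_gt0.
have := min_card_le m A; rewrite leq_eqVlt.
move=> /predU1P[A_full|/min_card_lt_enum].
  have [s [_ ss sA]] := has_at_least_min_card m A; rewrite A_full in ss.
  have Ax0 : A s`_0 by apply: sA; rewrite mem_nth ?ss.
  apply: (at_most_cubes_leq (m := (1 + 3) * (m + 3))).
    by rewrite A_full; lia.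
  apply: (at_most_cubes_rectangle (u := u) (v := f s`_0 - 2^-1)) => //.
  move=> [x y] [/= Ax ->].
  have := Au x Ax; rewrite /= in_itv /= mul1r => ->; split=> //.
  have := fA x _ Ax Ax0; rewrite ler_norml => ?.
  have : 1 <= m%:R * d by rewrite -ler_pdivrMr // mul1r.
  lra.
move=> [s <- As]; apply: (at_most_cubes_leq (m := 9 * size s)); first by lia.
apply: at_most_cubes_sub (at_most_cubes_graph_seq f s d0).
by move=> p [Ap pf]; split=> //; exact: As.
Qed.

Lemma unit_interval_column (m : nat) (x : R) : (0 < m)%N -> 0 <= x <= 1 ->
  exists2 k, (0 < k <= m)%N & k.-1%:R / m%:R <= x <= k%:R / m%:R.
Proof.
move=> m0 /andP[x0]; have mR : 0 < m%:R :> R by rewrite ltr0n.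
have xm0 : 0 <= x * m%:R by rewrite mulr_ge0 // ltW.
rewrite le_eqVlt => /predU1P[->|x1].
  exists m; rewrite ?m0 ?leqnn // divff ?gt_eqF // lexx andbT.
  by rewrite ler_pdivrMr // mul1r ler_nat leq_pred.
exists (Num.truncn (x * m%:R)).+1 => /=.
  by rewrite truncn_lt_nat // gtr_pMl.
by rewrite ler_pdivrMr // ler_pdivlMr // truncn_le xm0 ltW // truncnS_gt.
Qed.

Lemma at_most_cubes_graph d X f (m : nat) : X `<=` `[0, 1] -> 0 < d ->
  m%:R^-1 <= d -> d^-1 <= m%:R ->
  (forall x y, X x -> X y -> `|x - y| <= m%:R^-1 -> `|f x - f y| <= 2^-1) ->
  at_most_cubes d (graph_of X f) (16 * g_m X m).
Proof.
move=> X01 d0 md dm fX.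
have m0 : (0 < m)%N by rewrite -(ltr_nat R) (lt_le_trans _ dm) ?invr_gt0.
pose column k : set R := X `&` `[k.-1%:R / m%:R, k%:R / m%:R].
apply: (at_most_cubes_sub
    (G := \bigcup_(k in [set` index_iota 1 m.+1]) graph_of (column k) f)).
  move=> p [Xp pf]; have := X01 _ Xp; rewrite /= in_itv /=.
  move=> /(unit_interval_column m0)[k km pk]; exists k.
    by rewrite /= mem_index_iota ltnS.
  by split=> //; split; rewrite //= in_itv.
rewrite /g_m big_distrr /=; apply: at_most_cubes_bigcup => k.
rewrite mem_index_iota => /andP[k0 _].
have kE : k%:R / m%:R = k.-1%:R / m%:R + m%:R^-1 :> R.
  by rewrite -[k in LHS](prednK k0) -natr1 mulrDl mul1r.
apply: (at_most_cubes_graph_column (u := k.-1%:R / m%:R)) => //.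
  by move=> x [_]; rewrite /= !in_itv /= kE; lra.
move=> x y [Xx +] [Xy +]; rewrite /= !in_itv /= kE => xk yk.
by apply: fX => //; rewrite ler_norml; lra.
Qed.

End CubeCounts.

Section UniformContinuity.
Context {R : realType}.
Implicit Types (X : set R) (f g : R -> R).

Lemma unif_cont_on_near X f (e : R) : unif_cont_on X f -> 0 < e ->
  \forall m \near \oo, forall x y, X x -> X y ->
    `|x - y| <= m%:R^-1 -> `|f x - f y| <= e.
Proof.
move=> ucf /ucf[d d0 fd]; near=> m => x y Xx Xy xy.
apply/ltW/fd => //; apply: le_lt_trans xy _.
by near: m; exact: near_infty_natV_lt.
Unshelve. all: by end_near. Qed.

Lemma unif_cont_onD X f g : unif_cont_on X f -> unif_cont_on X g ->
  unif_cont_on X (f \+ g).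
Proof.
move=> ucf ucg e e0; have e20 : 0 < e / 2 by rewrite divr_gt0.
have [[df df0 fd] [dg dg0 gd]] := (ucf _ e20, ucg _ e20).
exists (Num.min df dg); first by rewrite lt_min df0.
move=> x y Xx Xy; rewrite lt_min => /andP[/(fd x y Xx Xy) + /(gd x y Xx Xy)].
by rewrite !ltr_norml /=; lra.
Qed.

Lemma lipschitz_unif_cont_on X f : lipschitz f -> unif_cont_on X f.
Proof.
move=> lip_f e e0; near +oo_R => K.
have K0 : 0 < K by near: K; exact: nbhs_pinfty_gt.
exists (e / K) => [|x y _ _]; first exact: divr_gt0.
rewrite ltr_pdivlMr // mulrC; apply: le_lt_trans.
suff : K.-lipschitz f by move=> /(_ (x, y)); apply.
by near: K.
Unshelve. all: by end_near. Qed.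

Lemma unif_cont_on_approx X f :
  (forall e : R, 0 < e ->
    exists2 g, unif_cont_on X g & forall x, X x -> `|f x - g x| <= e) ->
  unif_cont_on X f.
Proof.
move=> approx e e0; have e40 : 0 < e / 4 by rewrite divr_gt0.
have [g ucg fg] := approx _ e40; have [d d0 gd] := ucg _ e40.
exists d => // x y Xx Xy /(gd x y Xx Xy); move: (fg x Xx) (fg y Xy).
by rewrite !ler_norml !ltr_norml; lra.
Qed.

End UniformContinuity.

Section UpperBound.
Context {R : realType}.
Implicit Types (F : set (R * R)) (X : set R) (d t : R).

Lemma box_ratio_le d F n t : 0 < d < 1 -> at_most_cubes d F n ->
  ln n%:R <= t * - ln d -> (box_ratio F d <= t%:E)%E.
Proof.
move=> d01 [fin le_n] ln_le; rewrite /box_ratio asboolT // lee_fin.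
rewrite ler_pdivrMr ?oppr_gt0 ?ln_lt0 //.
by apply: le_trans ln_le; exact: le_ln_nat.
Qed.

Lemma upper_box_dim_le F (N : R -> nat) (C t : R) :
  (\forall d \near 0^'+, at_most_cubes d F (N d)) ->
  (\forall d \near 0^'+, ln (N d)%:R <= C - t * ln d) ->
  (upper_box_dim F <= t%:E)%E.
Proof.
move=> F_N N_le; apply/lee_addgt0Pr => e e0; rewrite -EFinD.
apply: near_limf_esup_le; near=> d; apply: (box_ratio_le (n := N d)).
- by apply/andP; split; near: d; [exact: nbhs_right_gt | exact: nbhs_right_lt].
- by near: d.
have : ln d <= - (C / e) by near: d; have /cvgrNyPle := @lnNy R; apply.
rewrite lerNr ler_pdivrMr // => C_le.
suff : ln (N d)%:R <= C - t * ln d by rewrite mulrDl !mulrN; lra.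
by near: d.
Unshelve. all: by end_near. Qed.

Lemma truncnS_inv_cvg : (Num.truncn (d^-1 : R)).+1 @[d --> 0^'+] --> \oo.
Proof.
apply/cvgrnyP; apply: (@ger_cvgy _ _ _ _ (fun d : R => d^-1)).
  by apply: nearW => d; rewrite ltW // truncnS_gt.
apply/cvgrVy; first exact: nbhs_right_gt.
exact: cvg_within.
Qed.

Lemma truncnS_inv_le d : 0 < d <= 1 -> (Num.truncn d^-1).+1%:R <= 2 / d.
Proof.
move=> /andP[d0 d1]; have d_inv : 1 <= d^-1 by rewrite invf_ge1.
have : (Num.truncn d^-1)%:R <= d^-1 by rewrite truncn_le; lra.
by rewrite -natr1; lra.
Qed.

Lemma upper_box_dim_graph_le X (f : R -> R) : X `<=` `[0, 1] ->
  unif_cont_on X f ->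
  (upper_box_dim (graph_of X f) <=
   growth_exponent (fun m => (g_m X m)%:R))%E.
Proof.
move=> X01 ucf; apply: lee_ub_fin => t g_lt_t.
have t0 : 0 < t.
  by rewrite -lte_fin (le_lt_trans (growth_exponent_nat_ge0 _) g_lt_t).
pose m d := (Num.truncn d^-1).+1.
apply: (upper_box_dim_le (N := fun d => (16 * g_m X (m d))%N)
                         (C := ln 16 + t * ln 2)); near=> d.
  have d0 : 0 < d by near: d; exact: nbhs_right_gt.
  have dm : d^-1 <= (m d)%:R by rewrite ltW // truncnS_gt.
  apply: at_most_cubes_graph => //.
    by rewrite -[leRHS]invrK lef_pV2 ?posrE ?invr_gt0.
  near: d; apply: (truncnS_inv_cvg (unif_cont_on_near ucf _)).
  by rewrite invr_gt0.
have d0 : 0 < d by near: d; exact: nbhs_right_gt.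
have d1 : d <= 1 by near: d; exact: nbhs_right_le.
have g_lt : ln ((g_m X (m d))%:R : R) < t * ln (m d)%:R.
  by near: d; exact: (truncnS_inv_cvg (growth_exponent_lt_near g_lt_t)).
have m_le : ln ((m d)%:R : R) <= ln 2 - ln d.
  rewrite -lnV ?posrE // -lnM ?posrE ?invr_gt0 //.
  by rewrite ler_ln ?posrE ?divr_gt0 // truncnS_inv_le // d0.
have : t * ln (m d)%:R <= t * (ln 2 - ln d) by rewrite ler_pM2l.
have := @ln_natM_le R 16 (16 * g_m X (m d)) (g_m X (m d)) isT (leqnn _).
lra.
Unshelve. all: by end_near. Qed.

End UpperBound.

Section LipschitzInterpolation.
Context {R : realType} {V : normedModType R}.
Implicit Types (f g : V -> R) (a b c L : R) (x z : V).

Lemma lipschitz_max f g : lipschitz f -> lipschitz g -> lipschitz (f \max g).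
Proof.
rewrite /lipschitz_on; apply: filterS2 => K lip_f lip_g [x y] xy.
move: (lip_f _ xy) (lip_g _ xy) => /=.
by rewrite !ler_norml !maxEle; do 2 case: ifPn; rewrite -?ltNge; lra.
Qed.

Lemma lipschitz_min f g : lipschitz f -> lipschitz g -> lipschitz (f \min g).
Proof.
rewrite /lipschitz_on; apply: filterS2 => K lip_f lip_g [x y] xy.
move: (lip_f _ xy) (lip_g _ xy) => /=.
by rewrite !ler_norml !minEle; do 2 case: ifPn; rewrite -?ltNge; lra.
Qed.

Lemma lipschitz_cone c L x : lipschitz (fun z => c + L * `|z - x|).
Proof.
apply: (@klipschitzW _ _ _ `|L|).
  exact: (@globally_properfilter _ _ (0, 0)).
move=> [y z] _ /=; rewrite opprD addrACA subrr add0r -mulrBr normrM.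
by rewrite ler_wpM2l // (le_trans (ler_dist_dist _ _)) // opprB addrA subrK.
Qed.

Lemma exists_separating_slope c (s : seq V) x : 0 <= c -> x \notin s ->
  exists2 L, 0 <= L & {in s, forall y, c <= L * `|y - x|}.
Proof.
move=> c0 xNs; pose slope y := c / `|y - x|.
have slope0 y : 0 <= slope y by rewrite divr_ge0.
exists (\sum_(y <- s) slope y); first exact: sumr_ge0.
move=> y ys; rewrite -ler_pdivrMr; last first.
  by rewrite normr_gt0 subr_eq0; apply: contraNneq xNs => <-.
by rewrite (big_rem y) //= lerDl sumr_ge0.
Qed.

Lemma lipschitz_interpolation a b (s : seq V) (v : V -> R) : a <= b ->
  {in s, forall x, a <= v x <= b} ->
  exists f, [/\ lipschitz f, forall z, a <= f z <= b & {in s, f =1 v}].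
Proof.
move=> ab; elim: s => [|x s IH] v_ab.
  exists (cst a); split=> // [|z]; last by rewrite lexx.
  apply: (@klipschitzW _ _ _ 0).
    exact: (@globally_properfilter _ _ (0, 0)).
  by move=> [y z] _ /=; rewrite subrr normr0 mul0r.
have [|f [lip_f f_ab fv]] := IH.
  by move=> y ys; rewrite v_ab // inE ys orbT.
have /andP[ax xb] := v_ab x (mem_head _ _).
have [xs|xNs] := boolP (x \in s).
  by exists f; split=> // y; rewrite inE => /predU1P[->|]; exact: fv.
have ba0 : 0 <= b - a by rewrite subr_ge0.
have [L L0 L_sep] := exists_separating_slope ba0 xNs.
(* [f] is clamped to the cone of slope [L] at [(x, v x)]: this changes no value
   on [s], where the cone is wider than [b - a] *)
pose lower z := v x - L * `|z - x|; pose upper z := v x + L * `|z - x|.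
exists (lower \max (upper \min f)); split.
- apply: lipschitz_max; last exact/lipschitz_min/lip_f/lipschitz_cone.
  by rewrite /lower; under eq_fun do rewrite -mulNr; exact: lipschitz_cone.
- move=> z; have := f_ab z; have : 0 <= L * `|z - x| by rewrite mulr_ge0.
  rewrite /= /lower /upper minEle maxEle.
  by do 2 case: ifPn; rewrite -?ltNge; lra.
move=> y; rewrite inE /= /lower /upper => /predU1P[->|ys].
  have := f_ab x; rewrite subrr normr0 mulr0 subr0 addr0.
  by rewrite minEle maxEle; do 2 case: ifPn; rewrite -?ltNge; lra.
have := L_sep y ys; have := f_ab y; rewrite -(fv y ys).
have : a <= v y <= b by rewrite v_ab // inE ys orbT.
by rewrite (fv y ys) minEle maxEle; do 2 case: ifPn; rewrite -?ltNge; lra.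
Qed.

End LipschitzInterpolation.

Lemma nested_balls_center {R : realType} {V : completeNormedModType R}
    (h : nat -> V) (a : nat -> R) : (forall i, 0 <= a i) ->
  (forall i, `|h i.+1 - h i| <= a i - a i.+1) ->
  exists l, forall i, `|l - h i| <= a i.
Proof.
move=> a0 h_step.
have h_near i j : (i <= j)%N -> `|h j - h i| <= a i - a j.
  move=> /subnKC <-; elim: (j - i)%N => [|k IH].
    by rewrite addn0 !subrr normr0.
  rewrite addnS -(subrK (h (i + k)%N) (h _)) -addrA.
  apply: le_trans (ler_normD _ _) _.
  by have := h_step (i + k)%N; lra.
have a_cvg : cvgn a.
  apply: nonincreasing_is_cvgn; last by exists 0 => _ [i _ <-].
  apply/nonincreasing_seqP => i; rewrite -subr_ge0; exact: le_trans (h_step i).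
have h_cvg : cvgn h.
  apply/cauchy_cvgP/cauchy_ballP => e e0.
  move/cvg_cauchy/cauchy_ballP: a_cvg => /(_ e e0).
  rewrite !near_map2; apply: filterS => -[i j] /=; rewrite -!ball_normE /=.
  apply: le_lt_trans.
  have [/h_near ij|/ltnW/h_near ji] := leqP i j.
    by rewrite distrC (le_trans ij) // ler_norm.
  by rewrite (le_trans ji) // distrC ler_norm.
exists (limn h) => i.
apply: (cvgr_to_le (cvg_norm (cvgB h_cvg (cvg_cst (h i))))).
near=> j; have ij : (i <= j)%N by near: j; exact: nbhs_infty_ge.
by rewrite (le_trans (h_near i j ij)) // lerBlDr lerDl.
Unshelve. all: by end_near. Qed.

Section SeparatingPerturbation.
Context {R : realType}.
Implicit Types (X : set R) (f g h : R -> R) (a d : R) (s : seq R).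

Definition half_open_column X (m k : nat) : set R :=
  X `&` `[k%:R / m%:R, k.+1%:R / m%:R[.

Lemma g_m_le_half_open_columns X (m : nat) :
  (g_m X m <= 2 * \sum_(0 <= k < m.+1) min_card m (half_open_column X m k))%N.
Proof.
pose N k := min_card m (half_open_column X m k).
apply: (@leq_trans (\sum_(1 <= k < m.+1) (N k.-1 + N k))).
  rewrite /g_m big_nat [leqRHS]big_nat.
  apply: leq_sum => -[|k] // /andP[_ km] /=.
  apply: leq_trans (min_cardU _ _ _); apply: min_card_sub => x [Xx] /=.
  rewrite in_itv /= => /andP[kx]; rewrite le_eqVlt => /predU1P[xE|xk].
    right; split=> //=; rewrite xE in_itv /= lexx ltr_pM2r ?ltr_nat ?ltnSn //.
    by rewrite invr_gt0 ltr0n; lia.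
  by left; split=> //=; rewrite in_itv /= kx.
rewrite big_split /= big_add1 /= mul2n -addnn; apply: leq_add.
  by rewrite [leqRHS]big_nat_recr //= leq_addr.
by rewrite [leqRHS]big_ltn // leq_addl.
Qed.

Lemma truncn_half_open_column X (m k : nat) (x : R) : (0 < m)%N ->
  half_open_column X m k x -> Num.truncn (x * m%:R) = k.
Proof.
move=> m0 [_ /=]; rewrite in_itv /= => /andP[kx xk].
by apply: truncn_def; rewrite -ler_pdivrMr ?ltr0n // kx -ltr_pdivlMr ?ltr0n.
Qed.

Lemma half_open_column_dist X (m k : nat) (x y : R) :
  half_open_column X m k x -> half_open_column X m k y -> `|x - y| <= m%:R^-1.
Proof.
move=> [_ +] [_ +]; rewrite /= !in_itv /= -natr1 mulrDl mul1r ler_norml.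
by lra.
Qed.

Definition separated_values d f s : Prop :=
  {in s &, forall x y, x != y -> d <= `|f x - f y|}.

Lemma at_least_cubes_separated X f d (S : nat -> seq R) (n : nat) : 0 < d ->
  (forall k, (k < n)%N -> [/\ uniq (S k), separated_values d f (S k) &
     {in S k, forall x, X x /\ k%:R * d <= x <= k.+1%:R * d}]) ->
  at_least_cubes d (graph_of X f) (\sum_(0 <= k < n) size (S k)).
Proof.
move=> d0 hS; pose cube k x : int * int := (k%:Z, Num.floor (f x / d)).
have -> : (\sum_(0 <= k < n) size (S k))%N =
    size [seq cube k x | k <- iota 0 n, x <- S k].
  by rewrite size_allpairs_dep sumnE big_map /index_iota subn0.
have memS k : k \in iota 0 n -> (k < n)%N by rewrite mem_iota.
apply: at_least_cubes_uniq.
  apply: allpairs_uniq_dep; first exact: iota_uniq.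
    by move=> k /memS/hS[].
  move=> _ _ /allpairsPdep[k [x [/memS/hS[_ sep _] xk ->]]]
         /allpairsPdep[l [y [_ yl ->]]] /= [kl floor_eq]; rewrite -kl in yl *.
  congr existT; apply/eqP/negPn/negP => /(sep x y xk yl).
  have /andP[] := floor_itv (f x / d); have /andP[] := floor_itv (f y / d).
  rewrite floor_eq !ler_pdivlMr // !ltr_pdivrMr // intrD mulrDl mul1r.
  by rewrite [d <= _]leNgt ltr_norml; lra.
move=> _ /allpairsPdep[k [x [/memS/hS[_ _ +] xk ->]]] => /(_ x xk)[Xx kx].
exists (x, f x); split=> //=; split; first by rewrite intrD -!pmulrn natr1.
have /andP[] := floor_itv (f x / d).
by rewrite ler_pdivlMr // ltr_pdivrMr // => -> /ltW.
Qed.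

Lemma distr_natM_ge (i j : nat) d : 0 <= d -> i != j ->
  d <= `|i%:R * d - j%:R * d|.
Proof.
move=> d0; rewrite -mulrBl normrM (ger0_norm d0) neq_ltn -!(ler_nat R) -!natr1.
move=> /orP[] ij; rewrite ler_peMl // ler_normr; apply/orP; [right|left]; lra.
Qed.

Lemma sparse_offset_le a (j m M : nat) : (j * M < m)%N -> 0 <= a ->
  6 <= a * M%:R -> j%:R * (3 / m%:R) <= a / 2.
Proof.
move=> jMm a0 aM; have m0 : 0 < m%:R :> R by rewrite ltr0n; lia.
rewrite mulrA ler_pdivrMr //.
have jM : j%:R * M%:R <= m%:R :> R by rewrite -natrM ler_nat ltnW.
have : j%:R * 6 <= j%:R * (a * M%:R) by rewrite ler_wpM2l.
have : a * (j%:R * M%:R) <= a * m%:R by rewrite ler_wpM2l.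
lra.
Qed.

(* The [j]-th chosen point of a column is sent to [3 j / m] above the value of
   [h] at the first one. *)
Lemma exists_separating_perturbation X h a (m M n : nat) :
  (0 < m)%N -> 0 < a -> 6 <= a * M%:R ->
  (forall x y, X x -> X y -> `|x - y| <= m%:R^-1 -> `|h x - h y| <= a / 2) ->
  exists phi (S : nat -> seq R),
    [/\ lipschitz phi, forall x, `|phi x| <= a & forall k, (k < n)%N ->
      [/\ uniq (S k), separated_values (3 / m%:R) (h \+ phi) (S k),
          {in S k, forall x, half_open_column X m k x} &
          (min_card m (half_open_column X m k) <= M * size (S k))%N]].
Proof.
move=> m0 a0 aM h_osc.
have M0 : (0 < M)%N by case: M aM => //; rewrite mulr0; lra.
have /choice[S hS] :=
  fun k => min_card_sparse_enum m (half_open_column X m k) M0.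
pose column (x : R) := S (Num.truncn (x * m%:R)).
have columnE k x : x \in S k -> column x = S k.
  have [_ SX _ _] := hS k; rewrite /column => /SX.
  by move=> /truncn_half_open_column->.
pose target x := h (column x)`_0 + (index x (column x))%:R * (3 / m%:R).
have target_near k x : x \in S k -> `|target x - h x| <= a.
  move=> xk; rewrite /target (columnE k x xk).
  have [_ SX _ sparse] := hS k; set i := index x (S k).
  have iS : (i < size (S k))%N by rewrite index_mem.
  have := sparse_offset_le (sparse i iS) (ltW a0) aM.
  have : 0 <= i%:R * (3 / m%:R) :> R by rewrite mulr_ge0 ?divr_ge0.
  have x0k : (S k)`_0 \in S k by rewrite mem_nth // (leq_ltn_trans _ iS).
  have := half_open_column_dist (SX _ x0k) (SX _ xk).
  by move=> /(h_osc _ _ (SX _ x0k).1 (SX _ xk).1); rewrite !ler_norml; lra.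
have [||phi [lip_phi phi_a phiE]] := @lipschitz_interpolation R R^o (- a) a
    [seq x | k <- iota 0 n, x <- S k] (fun x => target x - h x).
- lra.
- move=> _ /allpairsPdep[k [x [_ xk ->]]].
  by rewrite -ler_norml (target_near k).
exists phi, S; split=> // [x|k kn]; first by rewrite ler_norml.
have [uS SX le_M _] := hS k; split=> // x y xk yk xy.
have h_phi z : z \in S k ->
    (h \+ phi) z = h (S k)`_0 + (index z (S k))%:R * (3 / m%:R).
  move=> zk; rewrite /= phiE ?subrKC /target ?(columnE k) //.
  by apply/allpairsPdep; exists k, z; rewrite mem_iota.
rewrite !h_phi // opprD addrACA subrr add0r distr_natM_ge ?divr_ge0 //.
by apply: contraNneq xy => ij; rewrite -(nth_index 0 xk) ij nth_index.
Qed.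

Lemma exists_perturbation_many_cubes X h a : unif_cont_on X h -> 0 < a ->
  exists2 c : nat, (0 < c)%N & \forall m \near \oo, exists phi (n : nat),
    [/\ lipschitz phi, forall x, `|phi x| <= a, (g_m X m <= c * n)%N &
      forall g, (forall x, X x -> `|g x - (h x + phi x)| <= m%:R^-1) ->
        at_least_cubes m%:R^-1 (graph_of X g) n].
Proof.
move=> uch a0; have a20 : 0 < a / 2 by rewrite divr_gt0.
pose M := (Num.truncn (6 / a)).+1; exists (2 * M)%N => //.
have aM : 6 <= a * M%:R by rewrite mulrC -ler_pdivrMr // ltW // truncnS_gt.
near=> m; have m0 : (0 < m)%N by near: m; exact: nbhs_infty_gt.
have h_osc : forall x y, X x -> X y ->
    `|x - y| <= m%:R^-1 -> `|h x - h y| <= a / 2.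
  by near: m; exact: unif_cont_on_near.
have [phi [S [lip_phi phi_a hS]]] :=
  exists_separating_perturbation m.+1 m0 a0 aM h_osc.
exists phi, (\sum_(0 <= k < m.+1) size (S k))%N; split=> // [|g g_near].
  apply: leq_trans (g_m_le_half_open_columns X m) _.
  rewrite -mulnA leq_mul2l big_distrr /= !big_mkord leq_sum // => k _.
  by have [] := hS k (ltn_ord k).
apply: at_least_cubes_separated => [|k /hS[uS sep SX _]].
  by rewrite invr_gt0 ltr0n.
split=> // [x y xk yk xy|x /SX[Xx]]; last first.
  by rewrite /= in_itv /= => /andP[-> /ltW].
move: (sep x y xk yk xy) (g_near x (SX x xk).1) (g_near y (SX y yk).1).
by rewrite /= !ler_norml !ler_normr; lra.
Unshelve. all: by end_near. Qed.

End SeparatingPerturbation.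

Section LowerBound.
Context {R : realType}.
Implicit Types (F : set (R * R)) (f g h : R -> R) (a d t : R).

Lemma box_ratio_ge F d (n : nat) t : 0 < d < 1 -> at_least_cubes d F n ->
  t * - ln d <= ln n%:R -> (t%:E <= box_ratio F d)%E.
Proof.
move=> d01 F_n le_ln; rewrite /box_ratio.
case: asboolP => [fin|_]; last by rewrite leey.
rewrite lee_fin ler_pdivlMr ?oppr_gt0 ?ln_lt0 //.
by rewrite (le_trans le_ln) // le_ln_nat // F_n.
Qed.

Variables (X : set R) (r r1 : R).
Hypothesis rr1 : r < r1.
Hypothesis r1_lt_exponent : (r1%:E < growth_exponent (fun m => (g_m X m)%:R))%E.

Lemma exists_perturbation_box_ratio_ge h a : unif_cont_on X h -> 0 < a ->
  exists phi d, [/\ lipschitz phi, forall x, `|phi x| <= a, 0 < d <= a &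
    forall g, (forall x, X x -> `|g x - (h x + phi x)| <= d) ->
      (r%:E <= box_ratio (graph_of X g) d)%E].
Proof.
move=> uch a0; have [c c0 near_phi] := exists_perturbation_many_cubes uch a0.
have c_small : \forall m \near \oo, ln (c%:R : R) / (r1 - r) <= ln m%:R.
  exact: cvgry_ge cvgy_ln_nat _.
have m_large : \forall m \near \oo, (1 < m)%N /\ m%:R^-1 < a.
  exact: filterI (nbhs_infty_gt 1) (near_infty_natV_lt a0).
have [m [[phi [n [lip_phi phi_a g_le cubes]]] [cm [m1 ma]]] g_gt] :=
  growth_exponent_gt_meets r1_lt_exponent
    (filterI near_phi (filterI c_small m_large)).
have m0 : 0 < m%:R :> R by rewrite ltr0n ltnW.
exists phi, m%:R^-1; split=> // [|g /cubes g_n].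
  by rewrite invr_gt0 m0 ltW.
apply: box_ratio_ge g_n _; first by rewrite invr_gt0 m0 invf_lt1 // ltr1n.
rewrite lnV ?posrE // opprK; move: cm; rewrite ler_pdivrMr ?subr_gt0 // => cm.
by have := @ln_natM_le R _ _ _ c0 g_le; lra.
Qed.

(* A pair [(h, a)] stands for the ball of functions within [a] of [h]. *)
Definition refines (p q : (R -> R) * R) : Prop :=
  [/\ forall x, `|q.1 x - p.1 x| <= p.2 - q.2, q.2 <= p.2 / 2 &
    exists2 d, 0 < d <= p.2 &
      forall g, (forall x, X x -> `|g x - q.1 x| <= q.2) ->
        (r%:E <= box_ratio (graph_of X g) d)%E].

Lemma exists_refinement (p : (R -> R) * R) : unif_cont_on X p.1 -> 0 < p.2 ->
  exists q, [/\ unif_cont_on X q.1, 0 < q.2 & refines p q].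
Proof.
case: p => h a /= uch a0; have a20 : 0 < a / 2 by rewrite divr_gt0.
have [phi [d [lip_phi phi_a /andP[d0 da] dim_ge]]] :=
  exists_perturbation_box_ratio_ge uch a20.
exists (h \+ phi, d); split=> //=.
  exact: unif_cont_onD uch (lipschitz_unif_cont_on _ lip_phi).
split=> //= [x|]; last by exists d => //; rewrite d0; lra.
by rewrite addrC addKr (le_trans (phi_a x)) //; lra.
Qed.

Lemma exists_refining_sequence : exists (h : nat -> R -> R) (a : nat -> R),
  [/\ a 0 = 1, forall i, 0 < a i, forall i, unif_cont_on X (h i) &
      forall i, refines (h i, a i) (h i.+1, a i.+1)].
Proof.
pose uc_ball := {p : (R -> R) * R | unif_cont_on X p.1 /\ 0 < p.2}.
have uc0 : unif_cont_on X (cst 0 : R -> R).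
  by move=> e e0; exists 1 => // x y _ _ _; rewrite subrr normr0.
pose unit_ball : uc_ball := exist _ (cst 0, 1) (conj uc0 ltr01).
have [p|b [b0 b_refines]] := @dependent_choice uc_ball
    (fun p q => refines (sval p) (sval q)) _ unit_ball.
  have [ucp p0] := svalP p; apply: cid.
  have [q [ucq q0 pq]] := exists_refinement ucp p0.
  by exists (exist _ q (conj ucq q0)).
exists (fun i => (sval (b i)).1), (fun i => (sval (b i)).2); split.
- by rewrite b0.
- by move=> i; have [] := svalP (b i).
- by move=> i; have [] := svalP (b i).
- by move=> i; rewrite -!surjective_pairing.
Qed.

Lemma exists_upper_box_dim_graph_ge :
  exists2 f, unif_cont_on X f & (r%:E <= upper_box_dim (graph_of X f))%E.
Proof.
have [h [a [a0 a_gt0 uch href]]] := exists_refining_sequence.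
have a_le i : a i <= 1 / 2 ^+ i.
  elim: i => [|i IH]; first by rewrite a0 divr1.
  have [_ /= a_half _] := href i.
  by rewrite exprSr invfM mulrA (le_trans a_half) // ler_pM2r.
have a_small (e : R) : 0 < e -> exists i, a i < e.
  move=> e0; have [i _ /(_ i (leqnn i)) ie] :=
    near_infty_natSinv_expn_lt (PosNum e0).
  by exists i; exact: le_lt_trans (a_le i) ie.
have /choice[f f_near] x : exists l, forall i, `|l - h i x| <= a i.
  apply: (nested_balls_center (h := h ^~ x)) => i; first exact: ltW.
  by case: (href i) => h_step _ _; exact: h_step.
exists f.
  apply: unif_cont_on_approx => e /a_small[i ai]; exists (h i) => // x _.
  exact: le_trans (f_near x i) (ltW ai).
apply: meets_limf_esup_ge => V [/= e e0 eV]; have [i ai] := a_small e e0.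
have [_ _ [d /andP[d0 da] dim_ge]] := href i.
exists d; last by apply: dim_ge => x _; exact: f_near.
by apply: eV => //=; rewrite sub0r normrN gtr0_norm // (le_lt_trans da).
Qed.

End LowerBound.

Theorem theorem1 (R : realType) (X : set R) (hX : X `<=` `[0, 1]) :
  upper_graph_box_dim X =
  limn_esup (fun m : nat => (ln (g_m X m)%:R / ln m%:R)%:E).
Proof.
rewrite -[RHS]/(growth_exponent (fun m => (g_m X m)%:R)).
apply/eqP; rewrite eq_le; apply/andP; split.
  by apply: ge_ereal_sup => _ [f ucf <-]; exact: upper_box_dim_graph_le.
apply: lee_lb_fin => r1 r1_lt_exponent.
apply: lee_lb_fin => r; rewrite lte_fin => rr1.
have [f ucf dim_ge] := exists_upper_box_dim_graph_ge rr1 r1_lt_exponent.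
by apply: le_trans dim_ge _; apply: ereal_sup_ubound; exists f.
Qed.
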